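(* Any (randomized) LOCAL-model algorithm that finds a maximal independent set in graphs of maximum degree (at most) $\Delta$ with probability at least $1-1/n$ requires $\Omega(\min\{\Delta,\log\log n/\log\log\log n\})$ rounds. That is, there are constants $c>0$, $n_0$, $\Delta_0$ such that for all integers $n\ge n_0$ and $\Delta\ge\Delta_0$, no LOCAL-model algorithm with running time $T<c\min\{\Delta,\log\log n/\log\log\log n\}$ finds a maximal independent set with probability at least $1-1/n$ in every $n$-node graph of maximum degree at most $\Delta$.
   Context: LOCAL model: the input is a simple graph with $n$ nodes; nodes are computers, edges are communication links. Each node has a unique identifier from $\{1,2,\dotsc,\mathrm{poly}(n)\}$ (i.e. from $\{1,\dots,n^C\}$ for a fixed sufficiently large constant $C$), numbers its incident edges by ports $1,\dots,\deg$ in an arbitrary order, and knows $n$ and $\Delta$. Computation proceeds in synchronous rounds; in each round each node may send an arbitrary (unbounded) message to each neighbor, receive a message from each neighbor, and perform unbounded local computation. In a randomized algorithm each node additionally has its own independent stream of uniform random bits. A $T$-round algorithm is equivalently a function assigning to each node an output depending only on its radius-$T$ neighborhood (topology, port numbers, identifiers, random bits in it). The running time is fixed (Monte Carlo), and ''with probability at least $1-1/n$'' means that for every input graph in the class (with every assignment of identifiers and port numbers) the outputs of all nodes jointly form a correct global solution with at least that probability. For maximal independent set, each node must output whether it belongs to the set. Logarithms are to base $2$. *)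

(* Defs.v *)
From HB Require Import structures.
From mathcomp Require Import all_boot all_order all_algebra.
From mathcomp Require Import all_classical all_reals all_analysis.

Set Implicit Arguments.
Unset Strict Implicit.
Unset Printing Implicit Defensive.

Import Order.TTheory GRing.Theory Num.Theory.

Local Open Scope classical_set_scope.
Local Open Scope ring_scope.

Record sgraph (n : nat) := SGraph {
  adj : rel 'I_n;
  adj_sym : symmetric adj;
  adj_irr : irreflexive adj }.

Definition neighbors n (G : sgraph n) (v : 'I_n) : {set 'I_n} :=
  [set u | adj G v u]%SET.

Definition max_degree n (G : sgraph n) : nat :=
  (\max_(v < n) #|neighbors G v|)%N.

Definition independent n (G : sgraph n) : pred {set 'I_n} :=
  fun I => [forall u in I, forall v in I, ~~ adj G u v].

Definition is_MIS n (G : sgraph n) (I : {set 'I_n}) : bool :=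
  maxset (independent G) I.

(* [ports v] lists the neighbors of [v] in the order of the ports of [v]:
   the neighbor behind port [p] (counted from 0) is the [p]-th entry.  The
   order is arbitrary, and the two ends of an edge may number it differently. *)
Record labeling (C n : nat) (G : sgraph n) := Labeling {
  ident : 'I_n -> nat;
  ident_inj : injective ident;
  ident_range : forall v, (1 <= ident v <= n ^ C)%N;
  ports : 'I_n -> seq 'I_n;
  ports_uniq : forall v, uniq (ports v);
  ports_neighbors : forall v, ports v =i neighbors G v }.

(* What a node starts from is [n], the degree bound, its own identifier, its
   own degree and its own stream of random bits; in particular it does not see
   its index in ['I_n].  States and messages range over arbitrary types and
   the four functions are arbitrary.  [update s ms] is the state after a round
   in which the messages [ms], listed by receiving port, came in. *)
Record local_algorithm := LocalAlgorithm {
  state : Type;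
  message : Type;
  init : forall (n Delta id deg : nat) (bits : nat -> bool), state;
  send : state -> nat -> message;
  update : state -> seq message -> state;
  in_set : state -> bool }.

Section Execution.
Variables (A : local_algorithm) (Delta C n : nat).
Variables (G : sgraph n) (L : labeling C G) (r : 'I_n -> nat -> bool).

(* A neighbor [u] of [v] sends to [v] through its own port
   [index v (ports L u)]. *)
Fixpoint run (t : nat) (v : 'I_n) : state A :=
  if t is t'.+1 then
    update (run t' v)
      [seq send (run t' u) (index v (ports L u)) | u <- ports L v]
  else init A n Delta (ident L v) (size (ports L v)) (r v).

Definition output (T : nat) : {set 'I_n} := [set v | in_set (run T v)]%SET.

End Execution.

(* The space of all bit streams of the [n] nodes, with the product
   sigma-algebra. *)
Definition coordinate_events (n : nat) : set_system ('I_n -> nat -> bool) :=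
  [set E | exists v k, E = [set r | r v k = true]].

Notation bit_streams n := (g_sigma_algebraType (@coordinate_events n)).

(* All bits of all nodes are independent and uniform.  Every finite set of
   coordinates is contained in one of the form {(v, k) | k < m}, so this
   determines [P] uniquely. *)
Definition fair_bits (R : realType) (n : nat)
    (P : probability (bit_streams n) R) : Prop :=
  forall (m : nat) (b : 'I_n -> nat -> bool),
    P [set r | forall v k, (k < m)%N -> r v k = b v k]
      = ((2^-1 : R) ^+ (n * m))%:E.

(* Such a [P] exists: flip the coins by reading off the binary digits of a
   uniform point of [0, 1[, digit number k * n + v being the k-th bit of v. *)
Section FairBits.
Variable R : realType.

Let digit (x : R) (i : nat) : bool := odd (Num.truncn (x * 2 ^+ i.+1)).

Let truncn_half (x : R) : 0 <= x ->
  Num.truncn (x * 2) = ((Num.truncn x).*2 + odd (Num.truncn (x * 2)%R))%N.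
Proof.
move=> x0; have x20 : 0 <= x * 2 by rewrite mulr_ge0.
suff -> : Num.truncn x = (Num.truncn (x * 2)%R)./2.
  by rewrite addnC odd_double_half.
apply: truncn_def; have /andP[lo hi] := truncn_itv x20.
apply/andP; split.
  rewrite -(@ler_pM2r _ 2)// (le_trans _ lo)// -natrM ler_nat muln2.
  by rewrite -[X in (_ <= X)%N]odd_double_half leq_addl.
rewrite -(@ltr_pM2r _ 2)// (lt_le_trans hi)// -natrM ler_nat muln2 doubleS.
by rewrite -[X in (X < _)%N]odd_double_half; case: (odd _) => /=; rewrite ?ltnS.
Qed.

Let prefix_code (b : nat -> bool) :=
  fix code N := if N is N'.+1 then ((code N').*2 + b N')%N else 0%N.

Let digitsP (b : nat -> bool) (N : nat) (x : R) : 0 <= x < 1 ->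
  (forall i, (i < N)%N -> digit x i = b i) <->
  Num.truncn (x * 2 ^+ N) = prefix_code b N.
Proof.
move=> /andP[x0 x1]; elim: N => [|N IH].
  rewrite expr0 mulr1; split=> // _.
  by apply: truncn_def; rewrite x0.
have xN0 : 0 <= x * 2 ^+ N by rewrite mulr_ge0// exprn_ge0.
have := truncn_half xN0; rewrite -mulrA -exprSr => E.
split=> [H|].
  rewrite E /= -(H N (leqnn _)) -/(digit x N); congr (_.*2 + _)%N.
  by apply/IH => i iN; apply: H; exact: leqW.
rewrite E /= -/(digit x N) => H.
have [Hb Hc] : digit x N = b N /\ Num.truncn (x * 2 ^+ N) = prefix_code b N.
  have := congr1 odd H; rewrite !oddD !odd_double !addFb !oddb => Hb.
  by split=> //; move: H; rewrite Hb => /addIn /double_inj.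
by move=> i; rewrite ltnS leq_eqVlt => /predU1P[->//|]; exact: IH.2 Hc i.
Qed.

Let measurable_digit (i : nat) : measurable [set x : R | digit x i = true].
Proof.
have d0 : 0 < 2 ^+ i.+1 :> R by rewrite exprn_gt0.
rewrite (_ : [set _ | _] = \bigcup_(j in [set j | odd j])
    `[j%:R / 2 ^+ i.+1, j.+1%:R / 2 ^+ i.+1[%classic); last first.
  apply/seteqP; split=> [x /= xi|x [j /= oj]]; last first.
    rewrite in_itv/= ler_pdivrMr// ltr_pdivlMr// /digit => xj.
    by rewrite (truncn_def xj).
  exists (Num.truncn (x * 2 ^+ i.+1)) => //=.
  rewrite in_itv/= ler_pdivrMr// ltr_pdivlMr//; apply: truncn_itv.
  move: xi; rewrite /digit; case: leP => // y0.
  by rewrite (truncn0Pn _ _) // -ltNge (lt_trans y0).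
by apply: bigcup_measurable => j _; exact: measurable_itv.
Qed.

Let flips n (x : measurableTypeR R) : bit_streams n :=
  fun (v : 'I_n) k => digit x (k * n + v).

Let measurable_flips n : measurable_fun setT (@flips n).
Proof.
apply: (@measurability _ _ _ (bit_streams n) _ _ (@coordinate_events n)) => //.
move=> _ [_ [v [k ->]] <-]; rewrite setTI.
exact: (measurable_digit (k * n + v)).
Qed.

HB.instance Definition _ n :=
  isMeasurableFun.Build _ _ _ _ (@flips n) (@measurable_flips n).

Let uniform_digits (b : nat -> bool) (N : nat) :
  uniform_prob (@ltr01 R) [set x | forall i, (i < N)%N -> digit x i = b i]
    = ((2^-1 : R) ^+ N)%:E.
Proof.
set D := [set x | _].
have mD : measurable D.
  rewrite (_ : D = \bigcap_(i in [set i | (i < N)%N])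
      (if b i then [set x | digit x i = true]
       else ~` [set x | digit x i = true])).
    apply: bigcap_measurableType => i _.
    by case: (b i); [|apply: measurableC]; exact: measurable_digit.
  apply/seteqP; split=> x /= H i iN; have := H i iN.
    by move=> /= <-; case E: (digit x i) => //=; rewrite E.
  by case: (b i) => //= /negP /negbTE.
have d0 : 0 < 2 ^+ N :> R by rewrite exprn_gt0.
set c := prefix_code b N.
have cN : (c < 2 ^ N)%N.
  rewrite /c; elim: (N) => //= m IH; rewrite expnS mul2n.
  by case: (b m); rewrite ?addn1 ?addn0 ?ltn_double// ltn_Sdouble.
have DE : D `&` `[0, 1[ = `[c%:R / 2 ^+ N, c.+1%:R / 2 ^+ N[%classic.
  apply/seteqP; split=> x /=; rewrite !in_itv/=.
    move=> [Dx x01]; rewrite ler_pdivrMr// ltr_pdivlMr//.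
    rewrite /c -((digitsP b N x01).1 Dx); apply: truncn_itv.
    by rewrite mulr_ge0 ?exprn_ge0//; case/andP: x01.
  move=> /[dup] /andP[lo hi]; rewrite ler_pdivrMr// ltr_pdivlMr// => xc.
  have x01 : 0 <= x < 1.
    rewrite (le_trans _ lo) ?divr_ge0 ?ler0n ?ltW//= (lt_le_trans hi)//.
    by rewrite ler_pdivrMr// mul1r -natrX ler_nat.
  by split=> //; apply/(digitsP b N x01); exact: truncn_def.
rewrite /uniform_prob integral_uniform_pdf.
rewrite (eq_integral (cst 1%E)); last first.
  move=> x; rewrite inE/= => -[_]; rewrite in_itv/= /uniform_pdf => ->.
  by rewrite subr0 invr1.
rewrite integral_cst ?mul1e; last by apply: measurableI.
rewrite (_ : `[0, 1]%classic = `[0, 1[ `|` [set 1]); last first.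
  by rewrite (@setUitv1 _ _ _ 1 true)// bnd_simp.
have m1 : measurable (D `&` [set (1 : R)]) by apply: measurableI.
rewrite setIUr measureU0//; [|by apply: measurableI|]; last first.
  apply/eqP; rewrite -measure_le0 -(lebesgue_measure_set1 (1 : R)).
  by apply: le_measure; rewrite ?inE.
rewrite DE; have /= -> := @lebesgue_measure_itv R `[c%:R / 2 ^+ N, c.+1%:R / 2 ^+ N[.
rewrite lte_fin.
rewrite ltr_pM2r ?invr_gt0// ltr_nat ltnSn -EFinB -mulrBl -natr1.
by rewrite addrC addKr mul1r exprVn.
Qed.

Lemma fair_bits_exist (n : nat) :
  exists P : probability (bit_streams n) R, fair_bits P.
Proof.
exists (distribution (uniform_prob (@ltr01 R)) (@flips n)) => m b.
case: n b => [|n] b.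
  rewrite mul0n expr0 (_ : [set _ | _] = setT) ?probability_setT//.
  by apply/seteqP; split=> // r _ [].
rewrite mulnC.
rewrite -(uniform_digits (fun i => b (inord (i %% n.+1)) (i %/ n.+1)%N)).
congr (uniform_prob _ _); apply/seteqP; split=> x /= H.
  move=> i im; have := H (inord (i %% n.+1)) (i %/ n.+1)%N.
  rewrite /flips inordK ?ltn_mod// -divn_eq; apply.
  by rewrite ltn_divLR.
move=> v k km; rewrite /flips H.
  by rewrite modnMDl modn_small// inord_val divnMDl// divn_small// addn0.
by rewrite (@leq_trans (k.+1 * n.+1))// ?leq_mul2r ?km ?orbT// mulSn addnC ltn_add2r.
Qed.

End FairBits.

(* The measurability conjunct says that the outputs are random variables; it
   makes the event in the second conjunct measurable. *)
Definition finds_MIS_whp (R : realType) (n : nat)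
    (P : probability (bit_streams n) R)
    (A : local_algorithm) (Delta C T : nat) : Prop :=
  forall (G : sgraph n) (L : labeling C G), (max_degree G <= Delta)%N ->
    (forall v, measurable
       ([set r | v \in output A Delta L r T] : set (bit_streams n))) /\
    ((1 - n%:R^-1)%:E
       <= P [set r | is_MIS G (output A Delta L r T)])%E.

Definition log2 (R : realType) (x : R) : R := ln x / ln 2.

(* Main.v *)
Require Import Defs.
From mathcomp Require Import all_boot all_order all_algebra.
From mathcomp Require Import all_classical all_reals all_analysis.
From mathcomp Require Import fingroup perm zify ring lra.

(* Fixing the random bits. The instances below are subgraphs of bounded radius
   of one finite graph [H], hence fewer than [n]; a union bound gives one choice
   of random bits that is correct on all of them, so it suffices to refute
   deterministic algorithms that know their position in [H].

   Instances. [H] is bipartite with large girth and degree [3 K^2].  A subgraph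
   of [H] of degree at most [K^2], with every vertex split into [K] vertices of
   degree at most [K], has a line graph of degree at most [2 K], and a maximal
   independent set there is a set of at most [K] edges per vertex of [H], maximal
   with respect to the splitting.

   Round elimination. Such an edge set is encoded by the labels M, P, O, X of
   Balliu et al. ("Lower bounds for maximal matchings and maximal independent
   sets").  If a vertex outputs, instead of labels from its own view of radius
   [k + 1], the sets of labels that its neighbours could output given its view of
   radius [k], the sides of [H] swap roles, the radius drops by one, and the
   problem with parameters [(x, y)] becomes the one with [(x + y, y + 1)].  From
   [(0, K - 1)] it stays nontrivial for about [K / 2] steps.  At radius [0],
   double counting over the finite graph [H] gives a vertex whose neighbours can
   all be made to output the same forbidden label. *)

Set Implicit Arguments.
Unset Strict Implicit.
Unset Printing Implicit Defensive.

Import Order.TTheory GRing.Theory Num.Theory.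

(** * Labels *)

Inductive label := LM | LP | LO | LX.

Definition isM l := if l is LM then true else false.
Definition isMX l := match l with LM | LX => true | _ => false end.
Definition isMP l := match l with LM | LP => true | _ => false end.
Definition notP l := if l is LP then false else true.

(* Round elimination replaces labels by sets of labels; only these four sets
   of old labels are kept, each named by a new label. *)
Definition meaning (l' l : label) : bool :=
  match l' with
  | LM => isMX l
  | LP => match l with LO | LX => true | _ => false end
  | LO => ~~ isM l
  | LX => true
  end.

Section Constraints.
Local Open Scope nat_scope.
Variable C : finType.
Implicit Types (A : {set C}) (f g : C -> label).

Definition count_label (p : pred label) A f := #|[set a in A | p (f a)]%SET|.

(** At [x = y = 0] and without [LX], this and [passive_ok] describe maximal matching: exactly one
    [LM], or else only [LP] at an active and only [LO] at a passive vertex. The parameter [y]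
    permits extra [LM], and [x + y] bounds the exceptions in the second alternative. *)
Definition active_ok x y A f :=
  (0 < count_label isM A f) && (count_label isMX A f <= y.+1)
  || (count_label isMX A f <= y) && (count_label notP A f <= x + y).

Definition passive_ok x y A f :=
  (count_label isM A f <= y.+1) && (0 < count_label isMX A f)
  || (count_label isM A f <= y) && (count_label isMP A f <= x + y).

Lemma eq_in_count p A f g :
  {in A, f =1 g} -> count_label p A f = count_label p A g.
Proof.
move=> fg; apply: eq_card => a; rewrite !inE.
by case: (boolP (a \in A)) => //= /fg ->.
Qed.

Lemma eq_in_passive_ok x y A f g :
  {in A, f =1 g} -> passive_ok x y A f = passive_ok x y A g.
Proof. by move=> fg; rewrite /passive_ok !(eq_in_count _ fg). Qed.

Lemma leq_count (p q : pred label) A f g :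
  {in A, forall a, p (f a) -> q (g a)} -> count_label p A f <= count_label q A g.
Proof.
move=> pq; apply/subset_leq_card/fintype.subsetP => a; rewrite !inE.
by case/andP=> aA pa; rewrite aA pq.
Qed.

Lemma count_gt0 (p : pred label) A f a : a \in A -> p (f a) -> 0 < count_label p A f.
Proof. by move=> aA pa; apply/card_gt0P; exists a; rewrite inE aA. Qed.

(** The meanings of [LM] and [LP] avoid [LP], that of [LM] lies in [LM], [LX], and an old [LM]
    occurs only in the meanings of [LM] and [LX]. So each alternative of the old constraint implies
    the same alternative of the new one. *)
Lemma passive_of_meaning x y A f g :
  {in A, forall a, meaning (g a) (f a)} ->
  active_ok x y A f -> passive_ok (x + y) y.+1 A g.
Proof.
move=> gf /orP[/andP[/card_gt0P[a]]|/andP[MX nP]]; last first.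
  apply/orP; right; apply/andP; split.
    rewrite (leq_trans _ (leqW MX))// leq_count// => a /gf.
    by case: (g a).
  rewrite (leq_trans _ (leq_trans nP (leq_addr y.+1 _)))// leq_count// => a /gf.
  by case: (g a) => //; case: (f a).
rewrite !inE => /andP[aA fa] MX; apply/orP; left; apply/andP; split.
  by rewrite (leq_trans _ (leqW MX))// leq_count// => b /gf; case: (g b).
apply: (@count_gt0 _ _ _ a) => //.
by have := gf _ aA; case: (g a) => //; case: (f a) fa.
Qed.

(** Greedy selections from the sets bound how many of them contain a given label: picking [LM]
    wherever possible shows that at most [y + 1] sets contain [LM]. *)
Lemma exists_relabeling x y A (L : C -> set label) :
  {in A, forall a, exists l, L a l} ->
  (forall f, {in A, forall a, L a (f a)} -> passive_ok x y A f) ->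
  exists2 g, active_ok (x + y) y.+1 A g &
    {in A, forall a l, L a l -> meaning (g a) l}.
Proof.
move=> L0 LA.
have /choice[d dL] : forall a, exists l, a \in A -> L a l.
  by move=> a; have [/L0[l]|] := boolP (a \in A); [exists l | exists LM].
pose pref l1 l2 a := if `[< L a l1 >] then l1 else
                     if `[< L a l2 >] then l2 else d a.
have prefL l1 l2 : {in A, forall a, L a (pref l1 l2 a)}.
  move=> a aA; rewrite /pref; case: asboolP => // _.
  by case: asboolP => // _; exact: dL.
pose hasM := [set a in A | `[< L a LM >]]%SET.
have hasMy : #|hasM| <= y.+1.
  have := LA _ (prefL LM LM); rewrite /passive_ok.
  have -> : #|hasM| = count_label isM A (pref LM LM).
    apply: eq_card => a; rewrite !inE; case: (boolP (a \in A)) => //= aA.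
    have := prefL LM LM _ aA; rewrite /pref; case: asboolP => // nM.
    by case: (d a).
  by case/orP=> /andP[// /leqW].
(* A set inside [LM], [LX] can carry the new [LM], which gives the first alternative; the other sets
   become [LX] or [LO], according to whether they contain [LM]. *)
have [[a0 a0A a0L]|noMX] := pselect (exists2 a0, a0 \in A & forall l, L a0 l -> isMX l).
  exists (fun a => if a == a0 then LM else if `[< L a LM >] then LX else LO).
    apply/orP; left; apply/andP; split.
      by apply: (@count_gt0 _ _ _ a0); rewrite ?eqxx.
    rewrite (@leq_trans #|a0 |: hasM|)%SET//; last first.
      by rewrite cardsU1; case: (_ \notin _); rewrite // ltnW.
    apply/subset_leq_card/fintype.subsetP => a; rewrite !inE => /andP[aA].
    by case: eqP => //= _; case: ifP => //; rewrite aA.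
  move=> a aA l Ll /=; case: eqP => [aa0|_] /=.
    by apply: a0L; rewrite -aa0.
  by case: asboolP => //=; case: l Ll.
exists (fun a => if `[< L a LM >] then LX else if `[< L a LP >] then LO else LP).
  apply/orP; right; apply/andP; split.
    rewrite (leq_trans _ hasMy)//; apply/subset_leq_card/fintype.subsetP => a.
    by rewrite !inE; case: (a \in A); case: `[< L a LM >] => //; case: ifP.
  (* Every set now has an element outside [LM], [LX]. Picking [LP] if possible and [LO] otherwise
     rules out the first passive alternative, so the second one bounds the sets containing [LP]. *)
  pose hasP := [set a in A | `[< L a LP >]]%SET.
  have hasPxy : #|hasP| <= x + y.
    have notMX a : a \in A -> ~~ isMX (pref LP LO a).
      move=> aA; rewrite /pref; case: asboolP => // nP; case: asboolP => // nO.
      case: noMX; exists a => //.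
      by case=> // [/nP|/nO].
    have := LA _ (prefL LP LO); rewrite /passive_ok.
    have -> : count_label isMX A (pref LP LO) = 0.
      apply/eqP; rewrite cards_eq0; apply/eqP/setP => a; rewrite !inE.
      by case: (boolP (a \in A)) => //= /notMX/negbTE.
    rewrite andbF /= => /andP[_]; apply: leq_trans.
    apply/subset_leq_card/fintype.subsetP => a; rewrite !inE => /andP[aA aP].
    by rewrite aA /pref aP.
  rewrite addnC (@leq_trans (#|hasM :|: hasP|)%SET)//; last first.
    by rewrite (leq_trans (leq_card_setU _ _))// leq_add.
  apply/subset_leq_card/fintype.subsetP => a; rewrite !inE => /andP[-> /=].
  by do 2 case: (asbool _).
move=> a aA l Ll /=; case: asboolP => //= nM.
case: asboolP => //= nP; first by case: l Ll.
by case: l Ll.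
Qed.

End Constraints.

(** * Round elimination *)

(* Every colour class of edges is the perfect matching [v -- nb a v]. *)
Record colored_bigraph (C : finType) := ColoredBigraph {
  vertex :> finType;
  nb : C -> vertex -> vertex;
  side : vertex -> bool;
  nbK : forall a, involutive (nb a);
  side_nb : forall a v, side (nb a v) = ~~ side v }.

(** * Walks, girth and balls; local solutions *)

Section ColoredBigraph.
Local Open Scope nat_scope.
Variables (C : finType) (H : colored_bigraph C).
Implicit Types (u v w : H) (a b : C) (s : H -> {set C}) (p q : seq C).
Implicit Types (f g : H -> (H -> {set C}) -> C -> label).

(** Because of [foldr], the last colour of the list is the first step out of [v]. *)
Definition walk v p : H := foldr (@nb C H) v p.

Definition reduced p := sorted (fun a b => a != b) p.

(** Distinct reduced walks of length at most [r] from one vertex end at distinct vertices: up to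
    distance [r] the graph looks like a tree. *)
Definition girth_gt r := forall v p q, reduced p -> reduced q ->
  size p <= r -> size q <= r -> walk v p = walk v q -> p = q.

(** The inequality is strict: [ball 0] is empty and [ball 1] is the centre alone, so an index [k.+1]
    stands for radius [k]. *)
Definition ball k v w := exists2 p, size p < k & w = walk v p.

Lemma ball_center k v : ball k.+1 v v.
Proof. by exists [::]. Qed.

Lemma ball_leq k l v w : k <= l -> ball k v w -> ball l v w.
Proof. by move=> kl [x xk ->]; exists x => //; exact: leq_trans kl. Qed.

Lemma ball_nb k a v w : ball k (nb a v) w -> ball k.+1 v w.
Proof.
by move=> [x xk ->]; exists (rcons x a); rewrite ?size_rcons // /walk foldr_rcons.
Qed.

Lemma exists_reduced v p :
  exists q, [/\ reduced q, size q <= size p & walk v p = walk v q].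
Proof.
elim: p => [|a x [y [ry yx E]]]; first by exists [::].
case: y ry yx E => [|b y] ry yx E; first by exists [:: a]; split=> //=; rewrite E.
have [ab|ab] := eqVneq a b.
  exists y; split; first exact: path_sorted ry.
    exact: leqW (ltnW yx).
  by rewrite /= E ab /= nbK.
by exists [:: a, b & y]; split=> //=; [rewrite ab | rewrite E].
Qed.

Lemma nb_side_neq a v : nb a v != v.
Proof. by apply/eqP => /(congr1 (@side C H)); rewrite side_nb; case: side. Qed.

Lemma reduced_rcons p a b :
  reduced (rcons p b) -> b != a -> reduced (rcons (rcons p b) a).
Proof.
case: p => [|c x] /=; first by rewrite andbT.
by rewrite !rcons_path => -> /=; rewrite last_rcons.
Qed.

(* Reduced walks to [w] from two neighbours of [u] that both avoid [u] would be
   continued by two different reduced walks from [u] to [w]. *)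
Lemma ball_nb_meet r k u a b w : girth_gt r -> k < r -> a != b ->
  ball k.+1 (nb a u) w -> ball k.+1 (nb b u) w -> ball k u w.
Proof.
move=> girth kr ab.
have inner c : ball k.+1 (nb c u) w ->
    ball k u w \/
    exists x, [/\ reduced (rcons x c), size x <= k & w = walk u (rcons x c)].
  move=> [x0 x0k ->]; have [x [rx xx0 ->]] := exists_reduced (nb c u) x0.
  have xk : size x <= k by rewrite -ltnS (leq_ltn_trans xx0).
  case/lastP: x rx {xx0} xk => [|x d] rx xk.
    by right; exists [::]; split.
  have [dc|dc] := eqVneq d c.
    left; exists x; first by rewrite size_rcons in xk.
    by rewrite /walk foldr_rcons dc nbK.
  right; exists (rcons x d); split=> //; first exact: reduced_rcons.
  by rewrite /walk !foldr_rcons.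
move=> /inner[//|[x [rx xk wx]]] /inner[//|[y [ry yk wy]]].
case/eqP: ab; have : rcons x a = rcons y b.
  by apply: (girth u); rewrite ?size_rcons -?wx -?wy//; exact: leq_ltn_trans kr.
by move/rcons_inj => [].
Qed.

(* A choice [s] of edges at every vertex encodes the subgraph of [H] whose edges
   are those selected by both ends. *)
Definition mutual s v := [set a in s v | a \in s (nb a v)]%SET.

Definition degree_le D s := forall v, #|s v| <= D.

Definition eq_on_ball k v s s' := forall w, ball k v w -> s w = s' w.

(* A vertex that only sees its own selection must label all of it, without
   knowing which of these edges are present. *)
Definition labeled_edges k s v := if k <= 1 then s v else mutual s v.

(* [f v s a] is the label given by [v] to its edge of colour [a] in [s]; only
   the vertices of side [c] output labels. *)
Record solves D (c : bool) k m n f : Prop := Solves {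
  solves_local : forall v s s', eq_on_ball k v s s' -> f v s =1 f v s';
  solves_active : forall v s, side v = c -> degree_le D s ->
    active_ok m n (labeled_edges k s v) (f v s);
  solves_passive : forall u s, side u = ~~ c -> degree_le D s ->
    passive_ok m n (mutual s u) (fun a => f (nb a u) s a) }.

Section RoundElimination.
Variables (D r : nat) (c : bool) (k m n : nat)
  (f : H -> (H -> {set C}) -> C -> label).
Hypotheses (girth : girth_gt r) (k_gt0 : 0 < k) (kr : k < r)
  (fP : solves D c k.+1 m n f).

(** The selection [s'] ranges over the instances that [u] cannot tell from [s]. Membership of [a] in
    [s' (nb a u)] has to be required since [u] does not see it at [k = 1]. *)
Definition possible u s a : set label := fun l =>
  exists s', [/\ eq_on_ball k u s' s, degree_le D s', a \in s' (nb a u)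
                 & f (nb a u) s' a = l].

Lemma possible_local u s s' : eq_on_ball k u s s' -> possible u s = possible u s'.
Proof.
move=> ss'; apply/funext => a; apply/funext => l; apply/propext.
by split=> -[t [ts tD at' tl]]; exists t; split=> // w uw; rewrite ts // ss'.
Qed.

Lemma ball_center_gt0 v : ball k v v.
Proof. exact: ball_leq k_gt0 (ball_center 0 v). Qed.

Lemma labeled_edges_local u s s' :
  eq_on_ball k u s s' -> labeled_edges k s u = labeled_edges k s' u.
Proof.
move=> ss'; rewrite /labeled_edges ss'; last exact: ball_center_gt0.
case: leqP => // k1; apply/setP => a; rewrite !inE ss'; last exact: ball_center_gt0.
rewrite ss' //; apply: ball_leq k1 _; exact/(@ball_nb _ a)/ball_center.
Qed.

(** Each label [g a] is realised by a selection of its own. By the girth, the views of two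
    neighbours overlap only inside [ball k u], where all these selections agree with [s]; they glue
    to one selection, and there [f] is correct. *)
Lemma possible_passive u s (g : C -> label) : side u = ~~ c -> degree_le D s ->
  {in labeled_edges k s u, forall a, possible u s a (g a)} ->
  passive_ok m n (labeled_edges k s u) g.
Proof.
move=> uc sD; set A := labeled_edges k s u => gs.
have /choice[t tP] : forall a, exists t, degree_le D t /\ (a \in A ->
    [/\ eq_on_ball k u t s, a \in t (nb a u) & f (nb a u) t a = g a]).
  move=> a; have [/gs[t [ts tD au E]]|] := boolP (a \in A); first by exists t.
  by exists s.
pose outer w a := [/\ a \in A, ball k.+1 (nb a u) w & ~ ball k u w].
pose s' w := if pselect (exists a, outer w a) is left e then t (sval (cid e)) w else s w.
have s'D : degree_le D s'.
  by move=> w; rewrite /s'; case: pselect => // e; have [] := tP (sval (cid e)).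
have s'u : eq_on_ball k u s' s.
  by move=> w uw; rewrite /s'; case: pselect => // -[? []].
have s'nb a : a \in A -> eq_on_ball k.+1 (nb a u) s' (t a).
  move=> au w aw; have [_ /(_ au) [ts _ _]] := tP a.
  have [uw|uw] := pselect (ball k u w); first by rewrite s'u// ts.
  rewrite /s'; case: pselect => [e|[]]; last by exists a.
  case: (cid e) => b /= [bu bw _]; have [->//|ab] := eqVneq b a.
  by case: uw; exact: (ball_nb_meet girth kr ab).
have us' : s' u = s u by apply: s'u; exact: ball_center_gt0.
have mutA : mutual s' u = A.
  apply/setP => a; apply/idP/idP => [|aA].
    rewrite !inE us' /A /labeled_edges; case: leqP => [_ /andP[]//|k1].
    by have := labeled_edges_local s'u; rewrite /labeled_edges leqNgt k1 /= => <-;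
      rewrite !inE us'.
  have [_ /(_ aA) [_ aat _]] := tP a.
  rewrite !inE us' (s'nb _ aA); last exact: ball_center.
  rewrite aat andbT; move: aA; rewrite /A /labeled_edges.
  by case: ifP => // _; rewrite !inE => /andP[].
have := solves_passive fP uc s'D; rewrite mutA.
rewrite (@eq_in_passive_ok _ _ _ _ _ g) // => a au.
by rewrite (solves_local fP (s'nb _ au)); have [_ /(_ au) []] := tP a.
Qed.

Lemma possible_nonempty u s : degree_le D s ->
  {in labeled_edges k s u, forall a, exists l, possible u s a l}.
Proof.
move=> sD a; rewrite /labeled_edges; case: leqP => [k1 au|_].
  (* At [k = 1] only [s u] is visible, so every other vertex may select just [a]. *)
  pose s' w := if w == u then s u else [set a]%SET.
  exists (f (nb a u) s' a), s'; split=> //; last first.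
  - by rewrite /s' (negbTE (nb_side_neq _ _)) inE.
  - move=> w; rewrite /s'; case: eqP => // _; rewrite cards1.
    by apply: leq_trans (sD u); apply/card_gt0P; exists a.
  move=> w [p]; rewrite ltnNge; case: p => [_ ->|b p /negP[]]; last exact: leq_trans k1 _.
  by rewrite /s' eqxx.
by rewrite inE => /andP[au av]; exists (f (nb a u) s a), s.
Qed.

Definition relabels A (L : C -> set label) (g : C -> label) :=
  active_ok (m + n) n.+1 A g /\ {in A, forall a l, L a l -> meaning (g a) l}.

(** The choice depends on [A] and [L] alone, so that [eliminate] inherits the locality of
    [labeled_edges] and [possible]. *)
Definition relabel A (L : C -> set label) : C -> label :=
  if pselect (exists g : C -> label, relabels A L g) is left e then sval (cid e) else fun=> LM.

Definition eliminate u s := relabel (labeled_edges k s u) (possible u s).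

Lemma eliminateP u s : side u = ~~ c -> degree_le D s ->
  relabels (labeled_edges k s u) (possible u s) (eliminate u s).
Proof.
move=> uc sD; rewrite /eliminate /relabel; case: pselect => [e|]; first by case: (cid e).
case; have [|g|g] := @exists_relabeling C m n (labeled_edges k s u) (possible u s).
- exact: possible_nonempty.
- exact: possible_passive.
by move=> ? ?; exists g.
Qed.

Lemma solves_eliminate : solves D (~~ c) k (m + n) n.+1 eliminate.
Proof.
split=> [u s s' ss' a|u s uc us|v s vc sD].
- by rewrite /eliminate (possible_local ss') (labeled_edges_local ss').
- by have [] := eliminateP uc us.
have vc' : side v = c by rewrite vc negbK.
have := solves_active fP vc' sD; rewrite /labeled_edges ltnNge k_gt0 /=.
apply: passive_of_meaning => a; rewrite inE => /andP[av va].
have uc : side (nb a v) = ~~ c by rewrite side_nb vc'.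
have [_] := eliminateP uc sD; apply.
  by rewrite /labeled_edges; case: ifP => // _; rewrite inE va nbK.
by exists s; split; rewrite ?nbK.
Qed.

End RoundElimination.

Lemma round_elimination D r c k m n f : girth_gt r -> 0 < k < r ->
  solves D c k.+1 m n f -> exists g, solves D (~~ c) k (m + n) n.+1 g.
Proof.
by move=> girth /andP[k0 kr] fP; eexists; exact: solves_eliminate girth k0 kr fP.
Qed.


(** The second parameter never exceeds [n + k], so each of the [k] steps adds at most that much to
    the first. *)
Lemma iter_round_elimination D r c k m n f : girth_gt r -> k < r ->
  solves D c k.+1 m n f ->
  exists c' m' g, m' <= m + k * (n + k) /\ solves D c' 1 m' (n + k) g.
Proof.
move=> girth; elim: k c m n f => [|k IH] c m n f kr fP.
  by exists c, m, f; rewrite mul0n !addn0.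
have [g gP] := round_elimination girth (kr : 0 < k.+1 < r) fP.
have [c' [m' [h [m'le hP]]]] := IH _ _ _ _ (ltnW kr) gP.
exists c', m', h; rewrite addnS -addSn; split=> //.
by rewrite (leq_trans m'le)// -addnA leq_add2l mulSn leq_add2r addSn ltnW// ltnS leq_addr.
Qed.

(** * Impossibility at radius zero by double counting *)

Lemma exists_subset_card (T : finType) (B : {set T}) d : d <= #|B| ->
  exists2 A : {set T}, A \subset B & #|A| = d.
Proof.
move=> dB; exists [set x in take d (enum B)]%SET.
  by apply/fintype.subsetP => x; rewrite inE => /mem_take; rewrite mem_enum.
rewrite cardsE; have /card_uniqP -> := take_uniq d (enum_uniq (mem B)).
by rewrite size_take -cardE; case: ltngtP dB.
Qed.

Lemma sum_side_nb (P : H -> C -> bool) c :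
  \sum_(v : H | side v == c) #|[set a | P v a]%SET|
    = \sum_(u : H | side u == ~~ c) #|[set a | P (nb a u) a]%SET|.
Proof.
have cardE Q : #|[set a : C | Q a]%SET| = \sum_a (Q a : nat).
  by rewrite -sum1dep_card big_mkcond.
under eq_bigr do rewrite cardE; under [RHS]eq_bigr do rewrite cardE.
rewrite exchange_big [RHS]exchange_big /=; apply: eq_bigr => a _.
rewrite (reindex_inj (inv_inj (nbK (c := H) a))) /=; apply: eq_bigl => v.
by rewrite side_nb; case: side; case: c.
Qed.

(* A vertex of side [c] has fewer than [D] edges that never get label M or P,
   so by double counting some vertex of the other side has [D] edges that may
   all get M, or all get P. *)
Lemma no_solution_one D c m n f : 0 < #|H| -> 3 * D <= #|C| -> girth_gt 1 ->
  m + n < D -> n.+1 < D -> ~ solves D c 1 m n f.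
Proof.
move=> H0 CD girth mnD nD fP.
have D0 : 0 < D by apply: leq_ltn_trans nD.
have C0 : 0 < #|C| by apply: leq_trans CD; rewrite muln_gt0.
pose F v (A : {set C}) := f v (fun=> A).
have fF v s : f v s =1 F v (s v).
  by apply: (solves_local fP) => w [[|//] _ ->].
have Fok v (A : {set C}) : side v = c -> #|A| <= D -> active_ok m n A (F v A).
  by move=> vc AD; apply: (solves_active fP vc (s := fun=> A)).
pose able (p : pred label) v a :=
  [exists A : {set C}, [&& #|A| <= D, a \in A & p (F v A a)]].
pose able2 v a := able isM v a || able (predC notP) v a.
(* Otherwise [v] could select [D] colours, none of them labeled [LM] or [LP]; both active
   alternatives then fail, as [m + n < D]. *)
have many v : side v = c -> 2 * D <= #|[set a | able2 v a]%SET|.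
  move=> vc; pose B := ~: [set a | able2 v a]%SET.
  suff BD : #|B| < D.
    by rewrite -(leq_add2r #|B|) cardsC (leq_trans _ CD)// mulSn addnC leq_add2r ltnW.
  rewrite ltnNge; apply/negP => /exists_subset_card[A /fintype.subsetP AB AD].
  have nM a : a \in A -> ~~ isM (F v A a) && notP (F v A a).
    move=> aA; have := AB _ aA; rewrite !inE /able2 negb_or => /andP[/existsPn/(_ A)].
    rewrite AD leqnn aA /= => -> /existsPn/(_ A).
    by rewrite AD leqnn aA /= negbK.
  have := Fok v A vc (eq_leq AD); rewrite /active_ok.
  have -> : count_label isM A (F v A) = 0.
    apply/eqP; rewrite cards_eq0; apply/eqP/setP => a; rewrite !inE.
    by apply/negP => /andP[/nM/andP[/negP]].
  have -> : count_label notP A (F v A) = D.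
    rewrite -AD; apply: eq_card => a; rewrite !inE.
    by case: (boolP (a \in A)) => // /nM/andP[].
  by rewrite [D <= _]leqNgt mnD andbF.
have [u uc uD] : exists2 u : H, side u = ~~ c & 2 * D <= #|[set a | able2 (nb a u) a]%SET|.
  apply: contrapT => nou.
  have Nc : 0 < #|[pred v : H | side v == c]|.
    have /card_gt0P[v _] := H0; have /card_gt0P[a _] := C0; apply/card_gt0P.
    have [vc|vc] := eqVneq (side v) c; first by exists v; rewrite inE vc.
    by exists (nb a v); rewrite inE side_nb; move: vc; case: side; case: (c).
  pose N c := #|[pred v : H | side v == c]|.
  have NE c' : \sum_(v : H | side v == c') 2 * D = N c' * (2 * D).
    by rewrite sum_nat_const.
  have NN : N c = N (~~ c).
    have /card_gt0P[a _] := C0.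
    rewrite /N -!sum1_card /= (reindex_inj (inv_inj (nbK (c := H) a))).
    by apply: eq_bigl => v; rewrite !inE side_nb; case: side; case: (c).
  have lo : N c * (2 * D) <= \sum_(v : H | side v == c) #|[set a | able2 v a]%SET|.
    by rewrite -NE; apply: leq_sum => v /eqP; exact: many.
  have hi : \sum_(u : H | side u == ~~ c) #|[set a | able2 (nb a u) a]%SET|.+1 <= N c * (2 * D).
    rewrite NN -NE; apply: leq_sum => u /eqP uc; rewrite ltnNge; apply/negP => uD.
    by apply: nou; exists u.
  move: (leq_trans hi lo); rewrite sum_side_nb.
  under eq_bigr do rewrite -addn1.
  by rewrite big_split /= sum_nat_const muln1 -[X in _ <= X]addn0 leq_add2l leqNgt -/(N _) -NN Nc.
have [p pM [A [AD Ap]]] : exists2 p : pred label, p = isM \/ p = predC notP &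
    exists A : {set C}, #|A| = D /\ {in A, forall a, able p (nb a u) a}.
  have sub (p : pred label) : D <= #|[set a | able p (nb a u) a]%SET| ->
      exists A : {set C}, #|A| = D /\ {in A, forall a, able p (nb a u) a}.
    move=> /exists_subset_card[A /fintype.subsetP AB AD].
    by exists A; split=> // a /AB; rewrite inE.
  have [lt|] := ltnP #|[set a | able isM (nb a u) a]%SET| D; last first.
    by move=> /sub; exists isM => //; left.
  exists (predC notP); [by right | apply: sub].
  rewrite -(leq_add2l D) addnn -mul2n (leq_trans uD)//.
  rewrite (leq_trans _ (leq_add (ltnW lt) (leqnn _)))//.
  rewrite (leq_trans _ (leq_card_setU _ _))//; apply/subset_leq_card/fintype.subsetP => a.
  by rewrite !inE.
have /choice[B BP] : forall a, exists B : {set C}, #|B| <= D /\ (a \in A ->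
    a \in B /\ p (F (nb a u) B a)).
  move=> a; have [/Ap/existsP[B /and3P[? ? ?]]|] := boolP (a \in A); first by exists B.
  by exists finset.set0; rewrite cards0.
(* The vertex [u] selects [A], and its neighbour behind [a] selects the set [B a] that makes it
   output the bad label; girth keeps these neighbours distinct. *)
pose s w := if [pick a in A | nb a u == w] is Some a then B a else A.
have su : s u = A.
  rewrite /s; case: pickP => // a /andP[_]; by rewrite (negbTE (nb_side_neq _ _)).
have sD : degree_le D s.
  by move=> w; rewrite /s; case: pickP => [a _|_]; [have [] := BP a | rewrite AD].
have snb a : a \in A -> s (nb a u) = B a.
  move=> aA; rewrite /s; case: pickP => [b /andP[bA /eqP E]|/(_ a)]; last by rewrite aA eqxx.
  by have [] : [:: b] = [:: a] by [apply: (girth u)] => ->.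
have mu : mutual s u = A.
  apply/setP => a; rewrite inE su; case: (boolP (a \in A)) => //= aA.
  by rewrite snb //; have [_ /(_ aA)[]] := BP a.
have := solves_passive fP uc sD; rewrite mu.
have pA : {in A, forall a, p (f (nb a u) s a)}.
  by move=> a aA; rewrite fF snb //; have [_ /(_ aA)[]] := BP a.
have cD (q : pred label) : (forall l, p l -> q l) ->
    count_label q A (fun a => f (nb a u) s a) = D.
  move=> pq; rewrite -AD; apply: eq_card => a; rewrite !inE.
  by case: (boolP (a \in A)) => //= /pA/pq.
have c0 (q : pred label) : (forall l, p l -> ~~ q l) ->
    count_label q A (fun a => f (nb a u) s a) = 0.
  move=> pq; apply/eqP; rewrite cards_eq0; apply/eqP/setP => a; rewrite !inE.
  by apply/negP => /andP[/pA/pq/negP].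
rewrite /passive_ok; case: pM => pE; rewrite pE in cD c0.
  by rewrite cD // leqNgt nD [D <= n]leqNgt (ltnW nD).
by rewrite (c0 isMX) ?andbF ?(cD isMP) 1?[_ <= m + n]leqNgt ?mnD ?andbF //; case.
Qed.

Lemma no_solution D r c k n f : 0 < #|H| -> 3 * D <= #|C| -> girth_gt r -> k < r ->
  k.+1 * (n + k) + 1 < D -> ~ solves D c k.+1 0 n f.
Proof.
move=> H0 CD girth kr kD /(iter_round_elimination girth kr)[c' [m [g [mle gP]]]].
apply: (no_solution_one H0 CD _ _ _ gP).
- have r0 := leq_ltn_trans (leq0n k) kr.
  move=> v p q rp rq p1 q1; apply: girth => //; [exact: leq_trans p1 r0 |].
  exact: leq_trans q1 r0.
- by apply: leq_ltn_trans kD; rewrite mulSn addn1 leqW// addnC leq_add2l.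
- by apply: leq_ltn_trans kD; rewrite addn1 ltnS mulSn leq_addr.
Qed.

End ColoredBigraph.

(** * Conflict graphs *)

Section Instances.
Local Open Scope nat_scope.
Variables (C : finType) (H : colored_bigraph C) (K n : nat).
Variable emb : H * C -> 'I_n.
Hypothesis emb_inj : injective emb.
Implicit Types (u v w : H) (a b : C) (s : H -> {set C}) (i j : 'I_n).

(** An edge is named by its colour and its end on side [false], so both ends give it the same
    name. *)
Definition edge v a : H * C := if side v then (nb a v, a) else (v, a).

Lemma edge_nb v a : edge (nb a v) a = edge v a.
Proof. by rewrite /edge side_nb nbK; case: side. Qed.

Lemma edge_eq v w a b : edge v a = edge w b -> a = b /\ (v = w \/ v = nb b w).
Proof.
rewrite /edge; case: ifP => _; case: ifP => _ [vw ab]; subst b; split=> //.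
- by left; apply: (inv_inj (nbK (c := H) a)).
- by right; rewrite -vw nbK.
- by right.
- by left.
Qed.

(* Every vertex [v] of [s] is split into blocks of [K] selected edges, and
   edges conflict if they share such a block. *)
Definition block (X : {set C}) a := index a (enum X) %/ K.

Definition conflict s v a b :=
  [&& a \in mutual s v, b \in mutual s v & block (s v) a == block (s v) b].

(** Elements of ['I_n] that are in no conflict stay as isolated vertices, so every instance has
    exactly [n] nodes. *)
Definition conflict_adj s : rel 'I_n := fun i j => (i != j) &&
  [exists v, exists a, exists b,
    [&& conflict s v a b, i == emb (edge v a) & j == emb (edge v b)]].

Lemma conflict_adjP s i j : reflect
  (i != j /\ exists v a b, [/\ conflict s v a b, i = emb (edge v a) & j = emb (edge v b)])
  (conflict_adj s i j).
Proof.
apply: (iffP andP) => -[ij E]; split=> //; last first.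
  by have [v [a [b [cab -> ->]]]] := E; do 3 (apply/existsP; eexists);
    apply/and3P; split; [exact: cab | |].
have /existsP[v /existsP[a /existsP[b /and3P[cab /eqP ? /eqP ?]]]] := E.
by exists v, a, b.
Qed.

Lemma conflict_sym s v a b : conflict s v a b = conflict s v b a.
Proof. by rewrite /conflict andbCA eq_sym. Qed.

Lemma conflict_adj_sym s : symmetric (conflict_adj s).
Proof.
suff sub i j : conflict_adj s i j -> conflict_adj s j i.
  by move=> i j; apply/idP/idP; exact: sub.
move=> /conflict_adjP[ij [v [a [b [cab ? ?]]]]]; apply/conflict_adjP.
by rewrite eq_sym; split=> //; exists v, b, a; rewrite conflict_sym.
Qed.

Lemma conflict_adj_irr s : irreflexive (conflict_adj s).
Proof. by move=> i; rewrite /conflict_adj eqxx. Qed.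

Definition conflict_graph s : sgraph n :=
  SGraph (@conflict_adj_sym s) (@conflict_adj_irr s).

Lemma block_lt (X : {set C}) a : #|X| <= K * K -> a \in X -> block X a < K.
Proof.
move=> XK aX; have K0 : 0 < K.
  by case: (K) XK => //; rewrite mul0n leqn0 cards_eq0 => /eqP X0; rewrite X0 inE in aX.
by rewrite /block ltn_divLR// (leq_trans _ XK)// cardE index_mem mem_enum.
Qed.

Lemma card_inj_lt (X : {set C}) (h : C -> nat) k :
  {in X &, injective h} -> {in X, forall a, h a < k} -> #|X| <= k.
Proof.
move=> hinj hk; rewrite cardE -(size_map h) -(size_iota 0 k); apply: uniq_leq_size.
  rewrite map_inj_in_uniq ?enum_uniq// => a b; rewrite !mem_enum; exact: hinj.
by move=> _ /mapP[a + ->]; rewrite mem_enum mem_iota => /hk.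
Qed.

Lemma card_block (X : {set C}) m : 0 < K -> #|[set a in X | block X a == m]%SET| <= K.
Proof.
move=> K0; apply: (@card_inj_lt _ (fun a => index a (enum X) %% K)).
  move=> a b; rewrite !inE => /andP[aX /eqP am] /andP[bX /eqP bm] ab.
  have : index a (enum X) = index b (enum X).
    by rewrite (divn_eq (index a _) K) (divn_eq (index b _) K) ab -/(block X a) am -bm.
  by move=> E; rewrite -(nth_index a (s := enum X) (x := a)) ?mem_enum// E nth_index ?mem_enum.
by move=> a _; rewrite ltn_mod.
Qed.

(** An edge lies in one block at each of its two ends, and a block has at most [K] edges. *)
Lemma max_degree_conflict s : 0 < K -> max_degree (conflict_graph s) <= K + K.
Proof.
move=> K0; apply/bigmax_leqP => i _.
have [->|/set0Pn[j0]] := eqVneq (neighbors (conflict_graph s) i) finset.set0.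
  by rewrite cards0.
rewrite inE => /conflict_adjP[_ [v [a [_ [_ -> _]]]]].
pose fib w := [set emb (edge w b) | b in [set b in s w | block (s w) b == block (s w) a]]%SET.
have fibK w : #|fib w| <= K by rewrite (leq_trans (leq_imset_card _ _))// card_block.
rewrite (leq_trans _ (leq_add (fibK v) (fibK (nb a v))))//.
rewrite (leq_trans _ (leq_card_setU _ _))//; apply/subset_leq_card/fintype.subsetP => j.
rewrite !inE => /conflict_adjP[_ [w [a' [b [cab /emb_inj/esym/edge_eq[E vw] ->]]]]].
subst a'; move: cab => /and3P[_]; rewrite inE => /andP[bw _] /eqP gb.
by case: vw => <-; apply/orP; [left | right]; apply/imsetP; exists b => //; rewrite inE bw gb eqxx.
Qed.

Variable e : nat.
Hypothesis e_gt0 : 0 < e.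

Lemma ident_range_succ i : 1 <= i.+1 <= n ^ e.
Proof.
have n0 : 0 < n by exact: leq_ltn_trans (ltn_ord i).
by rewrite /= (leq_trans (ltn_ord i))// -[X in X <= _]expn1 leq_pexp2l.
Qed.

Lemma ident_inj_succ : injective (fun i : 'I_n => i.+1).
Proof. by move=> i j [] /val_inj. Qed.

Lemma mem_enum_neighbors s i :
  enum (neighbors (conflict_graph s) i) =i neighbors (conflict_graph s) i.
Proof. exact: mem_enum. Qed.

(** Identifiers do not depend on [s], and ports depend only on the set of neighbours; hence
    selections that agree near an edge look alike from it. *)
Definition conflict_labeling s : labeling e (conflict_graph s) :=
  Labeling ident_inj_succ ident_range_succ
    (fun i => enum_uniq (mem (neighbors (conflict_graph s) i)))
    (@mem_enum_neighbors s).

Section Locality.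
Variables (A : local_algorithm) (Delta : nat) (r : 'I_n -> nat -> bool).

Definition eq_near k v a s s' :=
  forall w, ball k v w \/ ball k (nb a v) w -> s w = s' w.

Lemma eq_near_shift k v w a b s s' : w = v \/ w = nb a v ->
  eq_near k.+1 v a s s' -> eq_near k w b s s'.
Proof.
move=> vw ss'.
have {}ss' : forall x, ball k.+1 w x -> s x = s' x.
  by move=> x; case: vw => -> wx; apply: ss'; [left | right].
by move=> x [wx|wx]; apply: ss'; [exact: ball_leq wx | exact: ball_nb wx].
Qed.

Lemma mutual_local s s' v : eq_on_ball 2 v s s' -> mutual s v = mutual s' v.
Proof.
move=> ss'; apply/setP => a; rewrite !inE ss'; last exact: ball_center.
by rewrite ss' //; apply: (@ball_nb _ _ _ a); exact: ball_center.
Qed.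

Lemma conflict_local s s' v a b : eq_on_ball 2 v s s' ->
  conflict s v a b = conflict s' v a b.
Proof.
by move=> ss'; rewrite /conflict (mutual_local ss') (ss' v)//; exact: ball_center.
Qed.

Lemma neighbors_local s s' v a : eq_near 2 v a s s' ->
  neighbors (conflict_graph s) (emb (edge v a))
    = neighbors (conflict_graph s') (emb (edge v a)).
Proof.
have sub t t' : eq_near 2 v a t t' ->
  forall j, conflict_adj t (emb (edge v a)) j -> conflict_adj t' (emb (edge v a)) j.
  move=> tt' j /conflict_adjP[ij [w [a' [b [cab E Ej]]]]]; apply/conflict_adjP.
  have /esym/edge_eq[ab vw] := emb_inj E; subst a'.
  split=> //; exists w, a, b; split=> //; rewrite -(conflict_local (s := t)) // => x wx.
  by case: vw wx => -> wx; apply: tt'; [left | right].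
move=> ss'; apply/setP => j; rewrite !inE; apply/idP/idP; apply: sub => // w vw.
exact/esym/ss'.
Qed.

(** The initial state already uses the degree, which depends on the selections of the neighbours of
    both ends; every round extends the view by one more step. *)
Lemma run_local t s s' v a : eq_near t.+2 v a s s' ->
  run A Delta (conflict_labeling s) r t (emb (edge v a))
    = run A Delta (conflict_labeling s') r t (emb (edge v a)).
Proof.
elim: t v a => [|t IH] v a ss' /=; first by rewrite (neighbors_local ss').
have ss1 : eq_near t.+2 v a s s' by apply: eq_near_shift ss'; left.
have ss2 : eq_near 2 v a s s'.
  by move=> w vw; apply: ss1; case: vw => vw; [left|right]; exact: ball_leq vw.
rewrite -(neighbors_local ss2) (IH _ _ ss1); congr update.
apply/eq_in_map => j; rewrite mem_enum inE => /conflict_adjP[_].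
move=> [w [a' [b [_ /emb_inj/esym/edge_eq[_ vw] ->]]]].
have sw : eq_near t.+2 w b s s' by apply: eq_near_shift vw ss'.
rewrite (IH _ _ sw) (neighbors_local (s' := s')) // => x wx.
by apply: sw; case: wx => wx; [left|right]; exact: ball_leq wx.
Qed.

End Locality.
End Instances.

(** * From maximal independent sets to labelings *)

Section MIS.
Variables (n : nat) (G : sgraph n) (I : {set 'I_n}).
Hypothesis I_MIS : is_MIS G I.

Lemma MIS_nonadj i j : i \in I -> j \in I -> ~~ adj G i j.
Proof.
move=> iI jI; have /maxsetP[/forallP/(_ i)] := I_MIS.
by rewrite iI => /forallP/(_ j); rewrite jI.
Qed.

Lemma MIS_adj i : i \notin I -> exists2 j, j \in I & adj G i j.
Proof.
move=> iI; have /maxsetP[_ Imax] := I_MIS.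
have [/existsP[j /andP[jI ij]]|noj] := boolP [exists j, (j \in I) && adj G i j].
  by exists j.
case/negP: iI; rewrite -(Imax (i |: I)%SET) ?setU11 ?finset.subsetUr//.
apply/forall_inP => j; rewrite !inE => jI; apply/forall_inP => k; rewrite !inE => kI.
have noadj l : l \in I -> ~~ adj G i l.
  by move=> lI; move/existsPn/(_ l): noj; rewrite lI.
case/predU1P: jI => [->|jI]; case/predU1P: kI => [->|kI].
- by rewrite adj_irr.
- exact: noadj.
- by rewrite adj_sym noadj.
- exact: MIS_nonadj.
Qed.

End MIS.

(** * Reduction to finitely many instances *)

Section Masks.
Local Open Scope nat_scope.
Variables (C : finType) (H : colored_bigraph C) (R : nat).
Implicit Types (v w : H) (s : H -> {set C}).

(** A table indexed by words of length at most [R] encodes a selection near [v]; vertices out of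
    reach select nothing. There are only finitely many tables, as the union bound requires. *)
Definition around v (phi : {ffun R.-bseq C -> {set C}}) w : {set C} :=
  if [pick p : R.-bseq C | walk v p == w] is Some p then phi p else finset.set0.

Definition mask v s := around v [ffun p : R.-bseq C => s (walk v p)].

Lemma mask_ball v s : eq_on_ball R.+1 v (mask v s) s.
Proof.
move=> w [p pR ->]; rewrite /mask /around.
case: pickP => [q /eqP <-|/(_ (Bseq (pR : size p <= R)))]; first by rewrite ffunE.
by rewrite /= eqxx.
Qed.

Lemma mask_local v s s' : eq_on_ball R.+1 v s s' -> mask v s = mask v s'.
Proof.
move=> ss'; congr (around v _); apply/ffunP => p; rewrite !ffunE; apply: ss'.
by exists p => //; rewrite ltnS size_bseq.
Qed.

End Masks.

Section InitialSolution.
Local Open Scope nat_scope.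
Variables (C : finType) (H : colored_bigraph C) (K n T R : nat).
Variable emb : H * C -> 'I_n.
Hypothesis emb_inj : injective emb.
Variables (A : local_algorithm) (Delta : nat) (r : 'I_n -> nat -> bool).
Variable e : nat.
Hypotheses (e_gt0 : 0 < e) (K_gt0 : 0 < K) (RT : T + 3 <= R).
Implicit Types (u v w : H) (a b : C) (s : H -> {set C}).

Definition mis s : {set 'I_n} :=
  output A Delta (conflict_labeling K emb e_gt0 s) r T.

Definition in_mis s v a := emb (edge v a) \in mis s.

Lemma in_misE s v a : in_mis s v a =
  Defs.in_set (run A Delta (conflict_labeling K emb e_gt0 s) r T (emb (edge v a))).
Proof. by rewrite /in_mis finset.in_set. Qed.

Lemma in_mis_local s s' v a : eq_near T.+2 v a s s' -> in_mis s v a = in_mis s' v a.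
Proof.
move=> ss'; rewrite !in_misE; congr (Defs.in_set _).
exact: (run_local K emb_inj e_gt0 A Delta r ss').
Qed.

Lemma in_mis_nb s v a : in_mis s (nb a v) a = in_mis s v a.
Proof. by rewrite /in_mis edge_nb. Qed.

(* M marks the edges of the independent set, and O the edges excluded by
   another edge in their own block. *)
Definition mis_label s v a : label :=
  if in_mis s v a then LM
  else if [exists b in mutual s v, in_mis s v b && (block K (s v) b == block K (s v) a)]
  then LO else LP.

Lemma isM_mis_label s v a : isM (mis_label s v a) = in_mis s v a.
Proof. by rewrite /mis_label; case: ifP => //; case: ifP. Qed.

Lemma isMX_mis_label s v a : isMX (mis_label s v a) = in_mis s v a.
Proof. by rewrite /mis_label; case: ifP => //; case: ifP. Qed.

Lemma mis_label_local k s s' v a : T.+3 <= k -> eq_on_ball k v s s' ->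
  mis_label s v a = mis_label s' v a.
Proof.
move=> Tk ss'.
have near b : eq_near T.+2 v b s s'.
  move=> w [vw|vw]; apply: ss'; last exact: ball_leq Tk (ball_nb vw).
  by apply: ball_leq vw; exact: ltnW.
have ss2 : eq_on_ball 2 v s s'.
  by move=> w vw; apply: ss'; apply: ball_leq vw; apply: leq_trans Tk.
have sv : s v = s' v by apply: ss2; exact: ball_center.
have E : in_mis s v = in_mis s' v by apply/funext => b; exact: in_mis_local.
by rewrite /mis_label E (mutual_local ss2) sv.
Qed.

Section CorrectOutput.
Variable s : H -> {set C}.
Hypotheses (sK : degree_le (K * K) s)
  (s_MIS : is_MIS (conflict_graph K emb s) (mis s)).

(** Independence leaves at most one edge per block, and there are at most [K] blocks. *)
Lemma card_in_mis v : #|[set a in mutual s v | in_mis s v a]%SET| <= K.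
Proof.
apply: (@card_inj_lt _ _ (block K (s v))) => [a b|a].
  rewrite finset.in_set => /andP[am aI]; rewrite finset.in_set => /andP[bm bI] gab.
  apply: contrapT => ab; have /negP[] := MIS_nonadj s_MIS aI bI.
  apply/conflict_adjP; split.
    by apply/eqP => /emb_inj/edge_eq[].
  by exists v, a, b; rewrite /conflict am bm gab eqxx.
by rewrite !finset.in_set => /andP[/andP[aX _] _]; exact: block_lt.
Qed.

(** By maximality, a member of the set conflicts with the edge. It cannot do so at [u], so it does
    at the other end. *)
Lemma in_mis_or_excluded u a : a \in mutual s u ->
  {in mutual s u, forall b, ~~ in_mis s u b} -> mis_label s (nb a u) a = LO.
Proof.
move=> au noI; rewrite /mis_label in_mis_nb (negbTE (noI _ au)).
have [j jI /conflict_adjP[_ [w [a' [b [cab]]]]]] := MIS_adj s_MIS (noI _ au).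
move=> /emb_inj/esym/edge_eq[E wu] Ej; subst a' j.
have /and3P[_ bw gab] := cab.
case: wu => wu; subst w; first by have /negP[] := noI _ bw.
case: ifP => // /negbT/negP[]; apply/existsP; exists b; rewrite bw eq_sym gab.
by rewrite andbT.
Qed.

End CorrectOutput.

Hypothesis all_MIS : forall v phi,
  is_MIS (conflict_graph K emb (around (R := R) v phi)) (mis (around v phi)).

Lemma mask_MIS v s : is_MIS (conflict_graph K emb (mask R v s)) (mis (mask R v s)).
Proof. exact: all_MIS. Qed.

Lemma degree_le_mask D v s : degree_le D s -> degree_le D (mask R v s).
Proof.
move=> sD w; rewrite /mask /around; case: pickP => [p _|_]; last by rewrite cards0.
by rewrite ffunE.
Qed.

(** A vertex with a member of the set has between 1 and [K] labels [LM], whence [y + 1 = K]. Without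
    one, an active vertex outputs only [LP], and a passive vertex receives only [LO]. *)
Lemma solves_mis_label :
  solves (K * K) false R.+1 0 K.-1 (fun v s => mis_label (mask R v s) v).
Proof.
have R3 : T.+3 <= R by rewrite -addn3.
have mask2 v s : mutual (mask R v s) v = mutual s v.
  apply: mutual_local => w vw; apply: mask_ball; apply: ball_leq vw.
  by rewrite ltnS (leq_trans _ R3).
split=> [v s s' ss' a|v s _ sD|u s _ sD]; first by rewrite (mask_local ss').
  have -> : labeled_edges R.+1 s v = mutual (mask R v s) v.
    by rewrite /labeled_edges leqNgt ltnS (leq_trans _ R3) //= mask2.
  set s' := mask R v s; have cK := card_in_mis (degree_le_mask v sD) (mask_MIS v s) v.
  have E (p : pred label) : (forall a, p (mis_label s' v a) = in_mis s' v a) ->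
      count_label p (mutual s' v) (mis_label s' v) = #|[set a in mutual s' v | in_mis s' v a]%SET|.
    by move=> pI; apply: eq_card => a; rewrite finset.in_set pI [RHS]finset.in_set.
  rewrite /active_ok (E _ (isM_mis_label _ _)) (E _ (isMX_mis_label _ _)).
  rewrite prednK //; case: posnP => [I0|_]; last by rewrite cK.
  rewrite I0 /= add0n.
  have noI : {in mutual s' v, forall b, ~~ in_mis s' v b}.
    move=> b bv; apply/negP => bI; move/eqP: I0; rewrite cards_eq0 => /eqP/setP/(_ b).
    by rewrite finset.in_set bv bI finset.in_set0.
  rewrite (_ : count_label _ _ _ = 0) //; apply/eqP; rewrite cards_eq0; apply/eqP/setP => a.
  rewrite finset.in_set finset.in_set0; apply/negP => /andP[av].
  rewrite /mis_label (negbTE (noI _ av)).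
  by case: ifP => // /existsP[b /and3P[bv bI _]]; have := noI _ bv; rewrite bI.
set s' := mask R u s.
(* The neighbours use masks with different centres, but all these masks agree with [s] on the region
   that determines the labels. *)
have labelE a : mis_label (mask R (nb a u) s) (nb a u) a = mis_label s' (nb a u) a.
  apply: (@mis_label_local T.+3) => // w wu.
  rewrite mask_ball; last by apply: ball_leq wu; rewrite leqW.
  by rewrite /s' mask_ball //; apply: (ball_leq _ (ball_nb wu)); rewrite ltnS.
rewrite -(mask2 u) -/s'; set B := mutual s' u.
rewrite (@eq_in_passive_ok _ _ _ _ _ (fun a => mis_label s' (nb a u) a)); last first.
  by move=> a _; exact: labelE.
have cK := card_in_mis (degree_le_mask u sD) (mask_MIS u s) u.
have E (p : pred label) : (forall v a, p (mis_label s' v a) = in_mis s' v a) ->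
    count_label p B (fun a => mis_label s' (nb a u) a) = #|[set a in B | in_mis s' u a]%SET|.
  by move=> pI; apply: eq_card => a; rewrite finset.in_set pI in_mis_nb [RHS]finset.in_set.
rewrite /passive_ok (E _ (isM_mis_label _)) (E _ (isMX_mis_label _)).
rewrite prednK //; case: posnP => [I0|_]; last by rewrite cK.
rewrite andbF I0 add0n /=.
have noI : {in B, forall b, ~~ in_mis s' u b}.
  move=> b bv; apply/negP => bI; move/eqP: I0; rewrite cards_eq0 => /eqP/setP/(_ b).
  by rewrite finset.in_set bv bI finset.in_set0.
rewrite (_ : count_label _ _ _ = 0) //; apply/eqP; rewrite cards_eq0; apply/eqP/setP => a.
rewrite finset.in_set finset.in_set0; apply/negP => /andP[aB].
by rewrite (in_mis_or_excluded (mask_MIS u s) aB noI).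
Qed.

End InitialSolution.

(** * A graph of large girth *)

(* Reduced words of length at most [r] form the ball of the [#|C|]-regular tree.
   Each colour acts on it by moving along the edge of that colour, if any, and
   the permutations generated that way give a finite graph of girth above [r]. *)
Section HighGirth.
Local Open Scope nat_scope.
Variables (C : finType) (r : nat).
Implicit Types (a b : C) (w : seq C).

Definition step a w :=
  if ohead w == Some a then behead w else if size w < r then a :: w else w.

Lemma step_size a w : size w <= r -> size (step a w) <= r.
Proof.
move=> wr; rewrite /step; case: ifP => _; first by rewrite size_behead (leq_trans (leq_pred _)).
by case: ltnP.
Qed.

Lemma step_reduced a w : reduced w -> reduced (step a w).
Proof.
rewrite /step; case: w => [|b w] /=; first by case: ifP.
move=> bw; case: ifPn => [_|ba]; first exact: path_sorted bw.
by case: ifP => //= _; rewrite bw andbT; apply: contraNneq ba => ->.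
Qed.

Lemma stepK a w : reduced w -> size w <= r -> step a (step a w) = w.
Proof.
move=> rw wr; rewrite {2}/step; case: ifPn => [|wa].
  case: w rw wr => [|b w] //= rw wr /eqP[ba]; subst b.
  rewrite /step wr; case: w rw {wr} => [|b w] //= /andP[ab _].
  by case: ifP => // /eqP[ba]; rewrite ba eqxx in ab.
case: ifP => wr'; first by rewrite /step /= eqxx.
by rewrite /step (negbTE wa) wr'.
Qed.

Definition tree_ball := {w : r.-bseq C | reduced w}.

Definition tree_step a (x : tree_ball) : tree_ball :=
  exist _ (Bseq (step_size a (size_bseq (val x)))) (step_reduced a (valP x)).

Lemma tree_stepK a : involutive (tree_step a).
Proof.
by move=> x; do 2 apply: val_inj; exact: stepK (valP x) (size_bseq (val x)).
Qed.

Definition tree_root : tree_ball := exist _ (Bseq (leq0n r : size [::] <= r)) isT.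

Lemma foldr_step w : reduced w -> size w <= r ->
  val (val (foldr tree_step tree_root w)) = w.
Proof.
elim: w => //= a w IH aw wr; rewrite IH; [|exact: path_sorted aw|exact: ltnW].
rewrite /step wr; case: w aw {IH wr} => //= b w /andP[ab _].
by case: ifP => // /eqP[ba]; rewrite ba eqxx in ab.
Qed.

Definition tree_perm a : {perm tree_ball} := perm (inv_inj (tree_stepK a)).

(** This is a Cayley graph of the permutations of the tree ball, doubled by a bit to make it
    bipartite. *)
Definition perm_nb a (v : {perm tree_ball} * bool) := ((v.1 * tree_perm a)%g, ~~ v.2).

Lemma perm_nbK a : involutive (perm_nb a).
Proof.
move=> [g b]; rewrite /perm_nb /= negbK -mulgA; congr (_, _).
by apply/permP => x; rewrite !permM !permE tree_stepK.
Qed.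

Definition perm_graph : colored_bigraph C :=
  ColoredBigraph (side := snd) perm_nbK (fun _ _ => erefl).

Lemma girth_perm_graph : girth_gt perm_graph r.
Proof.
move=> [g b] p q rp rq pr qr pq.
have walkE w x : (walk ((g, b) : perm_graph) w).1 x = foldr tree_step (g x) w.
  elim: w => //= a w IH; rewrite permM IH.
  by rewrite [LHS]permE.
rewrite -(foldr_step rp pr) -(foldr_step rq qr).
(* Evaluating the end of a walk at the preimage of the root under [g] returns the word itself. *)
by rewrite -[tree_root](permKV g) -!walkE pq.
Qed.

Lemma card_bseq_leq k : #|{: k.-bseq C}| <= #|C|.+1 ^ k.
Proof.
rewrite card_bseq; elim: k => [|k IH]; first by rewrite big_ord1.
rewrite big_ord_recr /= [_.+1 ^ k.+1]expnS mulSn leq_add// expnS leq_mul2l.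
by case: k {IH} => [|k]; rewrite ?expn0 ?orbT// leq_exp2r// leqnSn orbT.
Qed.

Lemma card_tree_ball : #|{: tree_ball}| <= #|C|.+1 ^ r.
Proof. by rewrite card_sig (leq_trans (max_card _))// card_bseq_leq. Qed.

Lemma card_perm_graph :
  #|perm_graph| <= 2 * (#|C|.+1 ^ r) ^ (#|C|.+1 ^ r).
Proof.
rewrite card_prod card_bool mulnC leq_mul2l /=.
have xz := card_tree_ball; set x := #|_| in xz; set z := _ ^ r in xz *.
have := @leq_card {perm tree_ball} {ffun tree_ball -> tree_ball} (@pval _) val_inj.
rewrite card_ffun => le1; apply: (leq_trans (le1 : _ <= x ^ x)).
have z0 : 0 < z by rewrite expn_gt0.
rewrite (@leq_trans (z ^ x)) ?leq_pexp2l//.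
by case: (posnP x) => [->|x0]; rewrite ?expn0// leq_exp2r.
Qed.

Lemma card_perm_graph_gt0 : 0 < #|perm_graph|.
Proof. by apply/card_gt0P; exists (1%g, true). Qed.

End HighGirth.

(** * Union bound *)

Section Combinatorial.
Local Open Scope nat_scope.

(** The factor [2 * z ^ z] bounds the centres and the other factor the tables. With
    [y = K ^ (2 * K)], the exponent is at most [1 + 2 * y^2 < y^3]. *)
Lemma count_instances_lt K k (z := (3 * (K * K)).+1 ^ k) : 4 <= k -> k * 2 <= K ->
  2 * z ^ z * 2 ^ (3 * (K * K) * z) < 2 ^ (K ^ (6 * K)).
Proof.
move=> k4 kK; have K8 : 8 <= K by lia.
have K0 : 0 < K by lia.
set y := K ^ (2 * K).
have K4y : K ^ 4 <= y by rewrite leq_pexp2l//; lia.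
have K34 : (3 * (K * K)).+1 <= K ^ 4.
  rewrite (_ : K ^ 4 = (K * K) * (K * K)); last by rewrite !expnS expn0; lia.
  have : 64 <= K * K by rewrite (leq_mul K8 K8).
  by nia.
have zy : z <= y.
  apply: (@leq_trans ((K ^ 4) ^ k)).
    by rewrite /z leq_exp2r//; lia.
  by rewrite -expnM /y leq_pexp2l//; lia.
have y8 : 8 <= y by rewrite (leq_trans K8)// -[X in X <= _]expn1 leq_pexp2l//; lia.
have zz : z ^ z <= 2 ^ (y * y).
  have z0 : 0 < z by rewrite expn_gt0.
  rewrite (@leq_trans (y ^ z)) ?leq_exp2r// (@leq_trans (y ^ y)) ?leq_pexp2l//; first lia.
  rewrite expnM leq_exp2r; last lia.
  exact/ltnW/ltn_expl.
rewrite (@leq_ltn_trans (2 ^ (1 + y * y + y * y)))//.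
  rewrite !expnD expn1 leq_mul ?leq_mul// leq_exp2l// leq_mul//.
  by rewrite (leq_trans _ K4y)// ltnW.
rewrite ltn_exp2l// (_ : K ^ (6 * K) = y * y * y); last first.
  by rewrite -!expnD; congr (_ ^ _); lia.
have : 64 <= y * y by rewrite (leq_mul y8 y8).
by nia.
Qed.

Variables (A : local_algorithm) (Delta n T e : nat).
Hypothesis e_gt0 : 0 < e.

Lemma no_local_MIS (K R : nat) (C := 'I_(3 * (K * K))) (H := perm_graph C R.+1)
    (emb : H * C -> 'I_n) (r : 'I_n -> nat -> bool) :
  T + 3 <= R -> R.+1 * 2 <= K -> injective emb ->
  (forall v phi, is_MIS (conflict_graph K emb (around (R := R) v phi))
                        (mis K T emb A Delta r e_gt0 (around v phi))) -> False.
Proof.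
move=> RT RK emb_inj all_MIS.
have K0 : 0 < K by apply: leq_trans RK.
have sol := solves_mis_label emb_inj K0 RT all_MIS.
apply: (no_solution _ _ (@girth_perm_graph C R.+1) _ _ sol) => //.
- exact: card_perm_graph_gt0.
- by rewrite card_ord.
have K1 : K.-1 < K by rewrite ltn_predL.
(* From [R + 1 <= K / 2], the quantity [(R + 1) * (K - 1 + R) + 1] is at most
   [3 * K^2 / 4 - K + 1]. *)
nia.
Qed.

Section UnionBound.
Local Open Scope classical_set_scope.
Variables (R : realType) (P : probability (g_sigma_algebraType (@coordinate_events n)) R).

Lemma exists_good_bits (J : finType) (E : J -> set ('I_n -> nat -> bool)) :
  (#|J| < n)%N ->
  (forall j, measurable (E j : set (g_sigma_algebraType (@coordinate_events n)))) ->
  (forall j, ((1 - n%:R^-1)%:E <= P (E j))%E) ->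
  exists r, forall j, E j r.
Proof.
move=> Jn mE PE; apply: contrapT => none.
pose F (i : nat) : set (g_sigma_algebraType (@coordinate_events n)) :=
  if insub i is Some i' then ~` E (enum_val (i' : 'I_#|J|)) else set0.
have mF i : measurable (F i).
  by rewrite /F; case: insub => // i'; exact: measurableC.
have FT : \big[setU/set0]_(i < #|J|) F i = setT.
  rewrite -bigcup_mkord; apply/seteqP; split=> // r _.
  have /existsNP[j nj] : ~ forall j, E j r by move=> Er; apply: none; exists r.
  exists (enum_rank j) => //=.
  rewrite /F insubT ?ltn_ord// => ?.
  by rewrite /= (_ : Sub _ _ = enum_rank j) ?enum_rankK//; apply: val_inj.
have n0 : (0 < n%:R :> R)%R by rewrite ltr0n (leq_ltn_trans _ Jn).
have PF (i : 'I_#|J|) : (P (F i) <= (n%:R^-1)%:E)%E.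
  rewrite /F valK probability_setC//; set p := P _.
  have : (p <= 1)%E by exact: probability_le1.
  have : ((1 - n%:R^-1)%:E <= p)%E by exact: PE.
  case: p => [x| |] //; rewrite -EFinB !lee_fin => x1 _.
  by rewrite lerBlDl -lerBlDr.
have : (P setT < 1)%E.
  rewrite -FT; apply: le_lt_trans (Boole_inequality P (fun i _ => mF i)) _.
  apply: le_lt_trans (lee_sum _ (fun i _ => PF i)) _.
  rewrite sumEFin lte_fin sumr_const card_ord -[ltLHS]mulr_natl ltr_pdivrMr// mul1r.
  by rewrite ltr_nat.
by rewrite probability_setT ltxx.
Qed.

(** The event is a finite union, over the maximal independent sets [X], of the events that [I r]
    equals [X]. *)
Lemma measurable_is_MIS (G : sgraph n) (I : ('I_n -> nat -> bool) -> {set 'I_n}) :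
  (forall v, measurable ([set r | v \in I r] : set (g_sigma_algebraType (@coordinate_events n)))) ->
  measurable ([set r | is_MIS G (I r)] : set (g_sigma_algebraType (@coordinate_events n))).
Proof.
move=> mI.
pose M v (X : {set 'I_n}) : set (g_sigma_algebraType (@coordinate_events n)) :=
  if v \in X then [set r | v \in I r] else ~` [set r | v \in I r].
have -> : [set r | is_MIS G (I r)] =
    \bigcup_(X in [set X : {set 'I_n} | is_MIS G X]) \bigcap_(v in [set: 'I_n]) M v X.
  apply/seteqP; split=> r /=.
    move=> mis; exists (I r) => //= v _; rewrite /M; case: ifP => //= vI.
    by rewrite vI.
  move=> [X mis Xr]; rewrite (_ : I r = X) //; apply/setP => v.
  have := Xr v Logic.I; rewrite /M; case: ifP => //= _ /negP /negbTE //.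
apply: fin_bigcup_measurable => [|X _]; first exact: finite_finset.
apply: fin_bigcap_measurable => [|v _]; first exact: finite_finset.
by rewrite /M; case: ifP => _; [|apply: measurableC]; exact: mI.
Qed.

End UnionBound.

Lemma not_finds_MIS (R : realType)
    (P : probability (g_sigma_algebraType (@coordinate_events n)) R) K :
  (T + 4) * 2 <= K -> K + K <= Delta -> 2 ^ (K ^ (6 * K)) <= n ->
  ~ finds_MIS_whp P A Delta e T.
Proof.
move=> TK KD Kn fA; pose k := T + 3.
pose C := 'I_(3 * (K * K)); pose H := perm_graph C k.+1.
have K0 : 0 < K by lia.
(* An instance is a centre together with a table of selections around it. *)
pose J := (H * {ffun k.-bseq C -> {set C}})%type.
have cardJ : #|{: J}| = #|H| * (2 ^ #|C|) ^ #|{: k.-bseq C}|.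
  rewrite card_prod card_ffun; congr (_ * _ ^ _).
  by rewrite -[LHS]cardsT -powersetT card_powerset cardsT.
have Jn : #|{: J}| < n.
  rewrite (leq_trans _ Kn)//.
  apply: leq_ltn_trans (@count_instances_lt K k.+1 _ _); last 2 first.
  - by rewrite /k; lia.
  - by rewrite /k; lia.
  have := card_perm_graph C k.+1; have := card_bseq_leq C k.
  rewrite cardJ card_ord; set z := _ ^ k.+1; set x := _ ^ k => bx Hz.
  rewrite leq_mul// -expnM leq_exp2l// leq_mul2l (leq_trans bx) ?orbT//.
  by rewrite /x /z expnS leq_pmull.
have HCn : #|{: H * C}| <= n.
  rewrite (leq_trans _ (ltnW Jn))// cardJ card_prod leq_mul2l -expnM.
  have b0 : 0 < #|{: k.-bseq C}|.
    by apply/card_gt0P; exists (Bseq (leq0n k : size [::] <= k)).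
  by rewrite (leq_trans (ltnW (ltn_expl #|C| (isT : 1 < 2))))// ?leq_pexp2l ?leq_pmulr ?orbT.
pose emb (x : H * C) := widen_ord HCn (enum_rank x).
have emb_inj : injective emb.
  by move=> x x' /(congr1 val) /= E; apply: (@enum_rank_inj (H * C)%type); exact: val_inj.
pose G (j : J) := conflict_graph K emb (around j.1 j.2).
pose L (j : J) := conflict_labeling K emb e_gt0 (around j.1 j.2).
have fG j := fA (G j) (L j) (leq_trans (max_degree_conflict emb_inj _ K0) KD).
have [|j|r rP] := @exists_good_bits R P J
    (fun j => [set r | is_MIS (G j) (output A Delta (L j) r T)])%classic Jn.
- by move=> j; apply: measurable_is_MIS; exact: (fG j).1.
- exact: (fG j).2.
apply: (@no_local_MIS K k emb r) => //; first by rewrite /k; lia.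
by move=> v phi; exact: (rP (v, phi)).
Qed.

End Combinatorial.

(** * Asymptotics *)

Section Asymptotics.
Local Open Scope ring_scope.
Variable R : realType.

Lemma ln2_gt0 : 0 < ln 2 :> R.
Proof. by rewrite ln_gt0// ltr1n. Qed.

Lemma log2_log2_large (M : R) : exists n0 : nat, forall n : nat, (n0 <= n)%N ->
  0 < log2 (n%:R : R) /\ M <= log2 (log2 (n%:R : R)).
Proof.
(* This is 2 to the power [2^M]. *)
pose x := expR (ln 2 * expR (ln 2 * M)) : R.
exists (Num.truncn x).+1 => n xn.
have nx : x <= n%:R.
  by rewrite (le_trans (ltW (truncnS_gt x)))// ler_nat.
have n0 : 0 < n%:R :> R by rewrite (lt_le_trans _ nx)// expR_gt0.
have lo : expR (ln 2 * M) <= log2 n%:R.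
  by rewrite /log2 ler_pdivlMr ?ln2_gt0// mulrC -ler_expR lnK.
have pos : 0 < log2 n%:R :> R by rewrite (lt_le_trans _ lo)// expR_gt0.
by split=> //; rewrite [leRHS]/log2 ler_pdivlMr ?ln2_gt0// mulrC -ler_expR lnK.
Qed.

Lemma div_log2_large (M : R) : exists x0 : R, forall x, x0 <= x ->
  2 <= x /\ M <= x / log2 x.
Proof.
(* With this [B], the bounds [ln x <= 2 * sqrt x] and [B <= sqrt x] give [M * ln x <= x * ln 2]. *)
pose B := 2 * `|M| / ln 2 : R.
exists (2 + B ^+ 2) => x xB.
have B0 : 0 <= B by rewrite divr_ge0 ?mulr_ge0// ltW// ln2_gt0.
have x2 : 2 <= x by have := sqr_ge0 B; lra.
have x1 : 1 < x by lra.
have x0 : 0 < x by lra.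
split=> //; have l2 := ln2_gt0; have lx : 0 < ln x by rewrite ln_gt0.
rewrite /log2 invf_div mulrA ler_pdivlMr//.
have sx : 0 < Num.sqrt x by rewrite sqrtr_gt0.
have lnx : ln x <= 2 * Num.sqrt x.
  rewrite -{1}(sqr_sqrtr (ltW x0)) lnXn// mulr2n.
  by have := ln_sublinear sx; lra.
have Bx : B <= Num.sqrt x.
  by rewrite -(ler_pXn2r (n := 2))// ?nnegrE ?sqrtr_ge0// sqr_sqrtr ?ltW//; lra.
rewrite (le_trans (ler_wpM2r (ltW lx) (ler_norm M)))//.
rewrite (le_trans (ler_wpM2l (normr_ge0 M) lnx))//.
have -> : `|M| * (2 * Num.sqrt x) = B * ln 2 * Num.sqrt x.
  by rewrite /B divfK ?gt_eqF//; ring.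
rewrite -[X in _ <= X * _](sqr_sqrtr (ltW x0)) expr2 mulrAC ler_pM2r//.
by rewrite ler_pM2r.
Qed.

Lemma exp_exp_le (K n : nat) (l := log2 (log2 (n%:R : R))) : (0 < K)%N ->
  0 < log2 (n%:R : R) -> 2 <= l -> K%:R <= l / log2 l / 24 ->
  (2 ^ (K ^ (6 * K)) <= n)%N.
Proof.
move=> K0 a0 l2' Kl; have l2 := ln2_gt0; have l1 : 1 < l by lra.
have n0 : 0 < n%:R :> R.
  by rewrite ltr0n lt0n; apply: contraTneq a0 => ->; rewrite /log2 ln0// mul0r ltxx.
have lnl : 0 < ln l by rewrite ln_gt0.
have KR : 0 < K%:R :> R by rewrite ltr0n.
have Kl' : 24 * K%:R * ln l <= l * ln 2.
  move: Kl; rewrite /log2 invf_div mulrA -/(log2 _) -/l ler_pdivlMr// ler_pdivlMr//.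
  by rewrite [K%:R * 24]mulrC.
(* Since [l >= 2], [Kl'] gives [K <= l]; then [6 * K * ln K <= l * ln 2], which is the goal after
   two logarithms. *)
have lnKl : ln K%:R <= ln l.
  rewrite ler_ln ?posrE//; last by lra.
  have ln2l : ln 2 <= ln l by rewrite ler_ln ?posrE//; lra.
  rewrite -(ler_pM2r l2); apply: le_trans Kl'.
  rewrite (le_trans (ler_wpM2l (ltW KR) ln2l))// ler_pM2r//; lra.
suff Ka : (K ^ (6 * K))%:R <= log2 (n%:R : R).
  rewrite -(ler_nat R) natrX -ler_ln ?posrE ?exprn_gt0// lnXn// -[leLHS]mulr_natl.
  by move: Ka; rewrite /log2 ler_pdivlMr.
rewrite natrX -ler_ln ?posrE ?exprn_gt0// lnXn// -[leLHS]mulr_natl.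
have -> : ln (log2 n%:R) = l * ln 2 by rewrite /l {2}/log2 divfK// gt_eqF.
apply: le_trans Kl'; rewrite natrM (le_trans (ler_wpM2l _ lnKl))//.
by rewrite ler_pM2r// ler_pM2r// ler_nat.
Qed.

End Asymptotics.

Local Open Scope ring_scope.

Theorem corollary4p16 (R : realType) :
  exists C0 : nat, forall C : nat, (C0 <= C)%N ->
  exists (c : R) (n0 Delta0 : nat), 0 < c /\
  forall n Delta T : nat, (n0 <= n)%N -> (Delta0 <= Delta)%N ->
    T%:R < c * Num.min (Delta%:R)
                       (log2 (log2 (n%:R)) / log2 (log2 (log2 (n%:R)))) ->
  forall P : probability (bit_streams n) R, fair_bits P ->
  forall A : local_algorithm, ~ finds_MIS_whp P A Delta C T.
Proof.
(* The instances use the identifiers from 1 to [n], so any exponent [C >= 1] will do. *)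
exists 1%N => C C_gt0.
have [x0 x0P] := div_log2_large (432 : R).
have [n0 n0P] := log2_log2_large x0.
(* With [K] the integer part of [m / 24], the condition [2 * (T + 4) <= K] follows from
   [m / 48 + 8 <= m / 24 - 1], that is, from [m >= 432]. *)
exists 96^-1, n0, 432%N; split=> // n Delta T /n0P[logn_gt0 /x0P[l2 ratio_ge]] Delta_ge.
set l := log2 (log2 _) in l2 ratio_ge *; set m := Num.min _ _ => T_lt P _ A.
have m_ge : 432 <= m by rewrite le_min ratio_ge ler_nat Delta_ge.
have [mDelta ml] : m <= Delta%:R /\ m <= l / log2 l.
  by split; rewrite ge_min lexx ?orbT.
pose K := Num.truncn (m / 24).
have /andP[Klo Khi] : K%:R <= m / 24 < K.+1%:R by apply: truncn_itv; lra.
rewrite -[K.+1%:R]natr1 in Khi.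
have TK : ((T + 4) * 2 <= K)%N by rewrite -(ler_nat R) natrM natrD; lra.
apply: (not_finds_MIS C_gt0 TK); first by rewrite -(ler_nat R) natrD; lra.
apply: (@exp_exp_le R K n _ logn_gt0 l2).
  by apply: leq_trans TK; rewrite muln_gt0 addn_gt0 orbT.
by rewrite (le_trans Klo)// ler_pM2r.
Qed.
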